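(* In the language universe $\mathscr U$, inheritance-calculus is strictly more expressive than the lazy $\lambda$-calculus: (a) inheritance-calculus can macro-express every $\mathscr U$-construct that the lazy $\lambda$-calculus can macro-express; and (b) the converse fails, i.e. there are $\mathscr U$-constructs that inheritance-calculus can macro-express but the lazy $\lambda$-calculus cannot.
   Context: **Documents.** A mixin body is a finite sequence of members; a member is a reference (a finite sequence of labels $[\ell_1,\dots,\ell_k]$, optionally with a null marker in second position) or a definition $\ell: m$ of a label by a mixin body $m$. A document $\mathrm{doc}$ is a mixin body. Labels are strings; a path is a finite sequence of labels; $()$ is the root; $p\triangleright\ell$ appends a label; $p\frown w$ concatenates; $\mathrm{init}(p)$, $\mathrm{last}(p)$ (undefined at $()$) are $p$ without its last label, resp. the last label. Set comprehensions omit terms in which a partial function is undefined. $\mathrm{at}(())=\mathrm{doc}$; $\mathrm{at}(p\triangleright\ell)$ is the unique body defined for $\ell$ in $\mathrm{at}(p)$; $\mathrm{has}(p,\ell)$ iff $\mathrm{at}(p)$ contains a definition of $\ell$. $\mathrm{lexical}(p,\ell)=0$ if $\mathrm{has}(p,\ell)$, else $1+\mathrm{lexical}(\mathrm{init}(p),\ell)$; $\mathrm{qualified}(p,\ell)=0$ if $\mathrm{last}(p)=\ell$, else $1+\mathrm{qualified}(\mathrm{init}(p),\ell)$. A reference $[s_1,\dots,s_k]$ written at $p$ is indexed as $(\mathrm{lexical}(\mathrm{init}(p),s_1),(s_1,\dots,s_k))$, or, if $s_2$ is null, as $(\mathrm{qualified}(\mathrm{init}(p),s_1),(s_3,\dots,s_k))$.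 $\mathrm{dom}(\mathrm{inherits})=\{p:p=()\text{ or }\mathrm{has}(\mathrm{init}(p),\mathrm{last}(p))\}$ and $\mathrm{inherits}(p)$ is the set of indexed references written in $\mathrm{at}(p)$. A document is well-formed if no mixin defines a label twice and every reference's climb finds a match before going past the root. **Semantics.** Least solution (pointwise inclusion) of: $\mathrm{supers}(())=\{((),())\}$, $\mathrm{supers}(p\triangleright\ell)=\{(\mathrm{init}(b),o): b\in\mathrm{bases}^*(p\triangleright\ell),o\in\mathrm{overrides}(b)\}$ ($\mathrm{bases}^*$ the reflexive-transitive closure); $\mathrm{overrides}(())=\{()\}$, $\mathrm{overrides}(p\triangleright\ell)=\{o:(\_,b)\in\mathrm{supers}(p),\ b\triangleright\ell\in\mathrm{dom}(\mathrm{inherits}),\ o\in\{p\triangleright\ell,b\triangleright\ell\}\}$; $\mathrm{bases}(())=\varnothing$, $\mathrm{bases}(p\triangleright\ell)=\{t:o\in\mathrm{overrides}(p\triangleright\ell),(n,w)\in\mathrm{inherits}(o),t\in\mathrm{resolve}(p,o,n,w)\}$; $\mathrm{resolve}(s,d,n,w)=\{c\frown w:c\in\mathrm{this}(\{s\},\mathrm{init}(d),n)\}$; $\mathrm{this}(S,d,0)=S$, and for $n>0$ $\mathrm{this}(S,d,n)=\bigcup_{c\in S}\bigcup_{(t,d)\in\mathrm{supers}(c)}\mathrm{this}(\{t\},\mathrm{init}(d),n-1)$. A document converges iff $\mathrm{supers}((\texttt{\_\_whnf},\texttt{\_\_parameter}))\neq\varnothing$. **Translation $\mathcal T$.** Variable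 names are labels, disjoint from \texttt{\_\_whnf}, \texttt{\_\_parameter}, \texttt{\_\_result}, \texttt{\_\_call}, \texttt{\_\_callee}. $\mathcal T(x)$ is the body with single reference $[x]$. $\mathcal T(\lambda x.M)$ is the body with single definition \texttt{\_\_whnf}, whose body defines $x$ (body: reference $[\texttt{\_\_parameter}]$), \texttt{\_\_parameter} (empty body), \texttt{\_\_result} (body $\mathcal T(M)$). $\mathcal T(M_1M_2)$ defines \texttt{\_\_callee} (body $\mathcal T(M_1)$), \texttt{\_\_call} (body: reference $[\texttt{\_\_callee},\texttt{\_\_whnf}]$ and definition \texttt{\_\_parameter} with body $\mathcal T(M_2)$), and \texttt{\_\_whnf} (body: reference $[\texttt{\_\_call},\texttt{\_\_result},\texttt{\_\_whnf}]$). **Language universe $\mathscr U$.** Its constructors are the union of those of inheritance-calculus (mixin, definition, reference) and of the lazy $\lambda$-calculus ($\lambda$-abstraction, application, variable), freely interleaved (a $\lambda$-expression may stand where a mixin body is expected and conversely). A $\mathscr U$-phrase is translated to inheritance-calculus from leaves to root, replacing each $\lambda$-construct by its $\mathcal T$-image and leaving inheritance-calculus constructs unchanged; $\mathscr U$-programs are the phrases whose translation is a well-formed document, and $\mathrm{eval}_{\mathscr U}(P)$ holds iff the translation of $P$ converges. Inheritance-calculus and the lazy $\lambda$-calculus (programs: closed $\lambda$-terms; evaluation: having a weak head normal form) are the sublanguages obtained by removing the other's constructors. **Macro-expressibility (Felleisen).** Let $L$ be a sublanguage of $\mathscr U$ and $\mathcal F$ a set of constructs of $\mathscr U$; let $L+\mathcal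 F$ be the sublanguage of $\mathscr U$ with the constructs of $L$ and those in $\mathcal F$. $L$ can macro-express $\mathcal F$ if there is a recursive map $\mathcal E$ from phrases of $L+\mathcal F$ to phrases of $L$ that sends programs to programs; is homomorphic on every construct of $L$ not in $\mathcal F$ (other constructs are left unchanged); satisfies $\mathrm{eval}_{\mathscr U}(P)\iff\mathrm{eval}_{\mathscr U}(\mathcal E(P))$ for every program $P$ of $L+\mathcal F$; and replaces each occurrence of a construct $F\in\mathcal F$ by a fixed $L$-context (syntactic abstraction) depending only on $F$, filled with the translations of its subexpressions (a binding construct's bound variable may appear in the context as a label). *)

(* Defs.v *)
From Stdlib Require Export Bool Ascii String List Arith.
Export ListNotations.
Open Scope list_scope.

Definition label := string.

(** * Phrases of the language universe

    [term H] is the raw syntax freely generated by the six constructors of the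
    universe, with holes named in [H]: phrases have no hole, contexts have
    numbered holes.  The two syntactic categories (bodies and members) are
    enforced by [sorted] below. *)

Inductive term (H : Type) : Type :=
| Hole (h : H)
| Mixin (ms : list (term H))
| Def (l : label) (m : term H)
| Ref (l : label) (null : bool) (ls : list label)
    (* [Ref l false ls] is the reference [l, ls]; [Ref l true ls] is
       [l, null, ls] *)
| Lam (x : label) (m : term H)
| App (m1 m2 : term H)
| Var (x : label).

Arguments Hole {H} h.
Arguments Mixin {H} ms.
Arguments Def {H} l m.
Arguments Ref {H} l null ls.
Arguments Lam {H} x m.
Arguments App {H} m1 m2.
Arguments Var {H} x.

Definition phrase := term Empty_set.
Definition context := term nat.

Definition whnf : label := "__whnf"%string.
Definition parameter : label := "__parameter"%string.
Definition result : label := "__result"%string.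
Definition call : label := "__call"%string.
Definition callee : label := "__callee"%string.

Definition variable_name (x : label) : bool :=
  negb (existsb (String.eqb x) [whnf; parameter; result; call; callee]).

Inductive sort := Body | Member.

Definition is_body (s : sort) : bool :=
  match s with Body => true | Member => false end.

Fixpoint sorted {H} (s : sort) (e : term H) : bool :=
  match e with
  | Hole _ => true
  | Mixin ms => is_body s && forallb (sorted Member) ms
  | Def _ m => negb (is_body s) && sorted Body m
  | Ref _ _ _ => negb (is_body s)
  | Lam x m => is_body s && variable_name x && sorted Body m
  | App m1 m2 => is_body s && sorted Body m1 && sorted Body m2
  | Var x => is_body s && variable_name x
  end.

(** * The translation to inheritance-calculus *)

Fixpoint translate {H} (e : term H) : term H :=
  match e with
  | Hole h => Hole h
  | Mixin ms => Mixin (map translate ms)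
  | Def l m => Def l (translate m)
  | Ref l null ls => Ref l null ls
  | Var x => Mixin [Ref x false []]
  | Lam x m =>
      Mixin [Def whnf (Mixin [Def x (Mixin [Ref parameter false []]);
                              Def parameter (Mixin []);
                              Def result (translate m)])]
  | App m1 m2 =>
      Mixin [Def callee (translate m1);
             Def call (Mixin [Ref callee false [whnf];
                              Def parameter (translate m2)]);
             Def whnf (Mixin [Ref call false [result; whnf]])]
  end.

(** * Documents

    A document is a body without lambda-constructs.  Paths are stored with
    their last label first: [nil] is the root, [l :: p] is [p] extended by
    [l], so that [init] and [last] are the tail and the head. *)

Definition path := list label.

(* The labels of a reference are in reading order, those of a path are not. *)
Definition extend (p : path) (w : list label) : path := rev w ++ p.

Definition definitions (l : label) (m : phrase) : list phrase :=
  match m with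
  | Mixin ms =>
      flat_map (fun e => match e with
                         | Def l' m' => if String.eqb l' l then [m'] else []
                         | _ => []
                         end) ms
  | _ => []
  end.

Definition defined_labels (ms : list phrase) : list label :=
  flat_map (fun e => match e with Def l _ => [l] | _ => [] end) ms.

Fixpoint at_path (doc : phrase) (p : path) : option phrase :=
  match p with
  | [] => Some doc
  | l :: q =>
      match at_path doc q with
      | Some m => match definitions l m with [m'] => Some m' | _ => None end
      | None => None
      end
  end.

Definition has (doc : phrase) (p : path) (l : label) : bool :=
  match at_path doc p with
  | Some m => match definitions l m with [] => false | _ => true end
  | None => false
  end.

(* [None] when the climb goes past the root without a match. *)
Fixpoint lexical (doc : phrase) (p : path) (l : label) : option nat :=
  if has doc p l then Some 0 else
  match p with
  | [] => None
  | _ :: q => option_map S (lexical doc q l)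
  end.

Fixpoint qualified (p : path) (l : label) : option nat :=
  match p with
  | [] => None
  | a :: q => if String.eqb a l then Some 0 else option_map S (qualified q l)
  end.

Definition index (doc : phrase) (p : path)
    (l : label) (null : bool) (ls : list label) : option (nat * list label) :=
  match p with
  | [] => None
  | _ :: q =>
      if null then option_map (fun n => (n, ls)) (qualified q l)
      else option_map (fun n => (n, l :: ls)) (lexical doc q l)
  end.

Definition in_dom (doc : phrase) (p : path) : Prop :=
  match p with [] => True | l :: q => has doc q l = true end.

(* [inherits doc p n w]: the indexed reference (n, w) is in inherits(p). *)
Definition inherits (doc : phrase) (p : path) (n : nat) (w : list label) : Prop :=
  in_dom doc p /\
  exists ms l null ls,
    at_path doc p = Some (Mixin ms) /\
    In (Ref l null ls) ms /\
    index doc p l null ls = Some (n, w).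

Definition well_formed (doc : phrase) : Prop :=
  forall p ms, at_path doc p = Some (Mixin ms) ->
    NoDup (defined_labels ms) /\
    forall l null ls, In (Ref l null ls) ms -> index doc p l null ls <> None.

(** * Semantics

    The least solution of the semantic equations, as mutually inductive
    predicates: [supers doc p i o] is (i, o) in supers(p), [overrides doc p o]
    is o in overrides(p), and so on; [this doc s d n t] is t in this({s}, d, n),
    the only sets passed to "this" being singletons. *)

Inductive supers (doc : phrase) : path -> path -> path -> Prop :=
| supers_root : supers doc [] [] []
| supers_step p l l' i o :
    bases_star doc (l :: p) (l' :: i) ->
    overrides doc (l' :: i) o ->
    supers doc (l :: p) i o

with overrides (doc : phrase) : path -> path -> Prop :=
| overrides_root : overrides doc [] []
| overrides_step p l i b o :
    supers doc p i b ->
    in_dom doc (l :: b) ->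
    o = l :: p \/ o = l :: b ->
    overrides doc (l :: p) o

with bases (doc : phrase) : path -> path -> Prop :=
| bases_step p l o n w t :
    overrides doc (l :: p) o ->
    inherits doc o n w ->
    resolve doc p o n w t ->
    bases doc (l :: p) t

with bases_star (doc : phrase) : path -> path -> Prop :=
| bases_star_refl p : bases_star doc p p
| bases_star_step p q r :
    bases doc p q -> bases_star doc q r -> bases_star doc p r

with resolve (doc : phrase) : path -> path -> nat -> list label -> path -> Prop :=
| resolve_intro s l d n w c :
    this doc s d n c -> resolve doc s (l :: d) n w (extend c w)

with this (doc : phrase) : path -> path -> nat -> path -> Prop :=
| this_zero s d : this doc s d 0 s
| this_succ s l d n t u :
    supers doc s t (l :: d) -> this doc t d n u -> this doc s (l :: d) (S n) u.

Definition converges (doc : phrase) : Prop :=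
  exists i o, supers doc [parameter; whnf] i o.

Definition eval (P : phrase) : Prop := converges (translate P).

(** * Constructs and sublanguages *)

Inductive construct := CMixin | CDef | CRef | CLam | CApp | CVar.

Fixpoint constructs {H} (e : term H) : list construct :=
  match e with
  | Hole _ => []
  | Mixin ms => CMixin :: flat_map constructs ms
  | Def _ m => CDef :: constructs m
  | Ref _ _ _ => [CRef]
  | Lam _ m => CLam :: constructs m
  | App m1 m2 => CApp :: constructs m1 ++ constructs m2
  | Var _ => [CVar]
  end.

(* A sublanguage of the universe is given by its set of constructs. *)
Definition language := construct -> Prop.

Definition inheritance_calculus : language :=
  fun k => In k [CMixin; CDef; CRef].

Definition lazy_lambda_calculus : language :=
  fun k => In k [CLam; CApp; CVar].

Definition plus (L F : language) : language := fun k => L k \/ F k.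

Definition term_of {H} (L : language) (e : term H) : Prop :=
  (exists s, sorted s e = true) /\ forall k, In k (constructs e) -> L k.

Definition phrase_of (L : language) (e : phrase) : Prop := term_of L e.

Definition program (L : language) (P : phrase) : Prop :=
  phrase_of L P /\ sorted Body P = true /\ well_formed (translate P).

(** * Contexts *)

Fixpoint holes {H} (e : term H) : list H :=
  match e with
  | Hole h => [h]
  | Mixin ms => flat_map holes ms
  | Def _ m | Lam _ m => holes m
  | App m1 m2 => holes m1 ++ holes m2
  | Ref _ _ _ | Var _ => []
  end.

Definition context_of (L : language) (arity : nat) (C : context) : Prop :=
  term_of L C /\ forall i, In i (holes C) -> i < arity.

(* Filling is capturing, as usual for contexts. *)
Fixpoint fill (C : context) (es : list phrase) : phrase :=
  match C with
  | Hole i => nth i es (Mixin [])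
  | Mixin Cs => Mixin (map (fun C' => fill C' es) Cs)
  | Def l C' => Def l (fill C' es)
  | Ref l null ls => Ref l null ls
  | Lam x C' => Lam x (fill C' es)
  | App C1 C2 => App (fill C1 es) (fill C2 es)
  | Var x => Var x
  end.

(* A symbol is an occurrence of a construct stripped of its subexpressions:
   what remains is its arity and the labels it carries. *)
Inductive symbol :=
| SMixin (n : nat)
| SDef (l : label)
| SRef (l : label) (null : bool) (ls : list label)
| SLam (x : label)
| SApp
| SVar (x : label).

Definition construct_of (s : symbol) : construct :=
  match s with
  | SMixin _ => CMixin
  | SDef _ => CDef
  | SRef _ _ _ => CRef
  | SLam _ => CLam
  | SApp => CApp
  | SVar _ => CVar
  end.

Definition arity (s : symbol) : nat :=
  match s with
  | SMixin n => n
  | SDef _ | SLam _ => 1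
  | SApp => 2
  | SRef _ _ _ | SVar _ => 0
  end.

Definition symbol_of (e : phrase) : symbol :=
  match e with
  | Hole h => match h with end
  | Mixin ms => SMixin (List.length ms)
  | Def l _ => SDef l
  | Ref l null ls => SRef l null ls
  | Lam x _ => SLam x
  | App _ _ => SApp
  | Var x => SVar x
  end.

Definition subexpressions (e : phrase) : list phrase :=
  match e with
  | Mixin ms => ms
  | Def _ m | Lam _ m => [m]
  | App m1 m2 => [m1; m2]
  | Hole _ | Ref _ _ _ | Var _ => []
  end.

Definition map_subexpressions (f : phrase -> phrase) (e : phrase) : phrase :=
  match e with
  | Hole h => Hole h
  | Mixin ms => Mixin (map f ms)
  | Def l m => Def l (f m)
  | Ref l null ls => Ref l null ls
  | Lam x m => Lam x (f m)
  | App m1 m2 => App (f m1) (f m2)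
  | Var x => Var x
  end.

(** * Recursive maps on phrases

    Computability is definability in the weak call-by-value lambda-calculus L
    (closed terms in de Bruijn notation, substitution without lifting), on
    Scott encodings. *)

Inductive lterm :=
| Ix (n : nat)
| Ap (s t : lterm)
| Ab (s : lterm).

Fixpoint lsubst (s : lterm) (k : nat) (u : lterm) : lterm :=
  match s with
  | Ix n => if Nat.eqb n k then u else Ix n
  | Ap s1 s2 => Ap (lsubst s1 k u) (lsubst s2 k u)
  | Ab s1 => Ab (lsubst s1 (S k) u)
  end.

Fixpoint lbound (k : nat) (s : lterm) : Prop :=
  match s with
  | Ix n => n < k
  | Ap s1 s2 => lbound k s1 /\ lbound k s2
  | Ab s1 => lbound (S k) s1
  end.

Inductive lstep : lterm -> lterm -> Prop :=
| lstep_beta s t : lstep (Ap (Ab s) (Ab t)) (lsubst s 0 (Ab t))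
| lstep_left s s' t : lstep s s' -> lstep (Ap s t) (Ap s' t)
| lstep_right s t t' : lstep t t' -> lstep (Ap s t) (Ap s t').

Inductive lsteps : lterm -> lterm -> Prop :=
| lsteps_refl s : lsteps s s
| lsteps_step s t u : lstep s t -> lsteps t u -> lsteps s u.

(* The [i]-th (from 0) of [n] constructors applied to the closed encodings
   [args]: \c_0 ... c_{n-1}. c_i args. *)
Definition scott (n i : nat) (args : list lterm) : lterm :=
  Nat.iter n Ab (fold_left Ap args (Ix (n - S i))).

Definition enc_bool (b : bool) : lterm := scott 2 (if b then 0 else 1) [].

Definition enc_ascii (a : ascii) : lterm :=
  match a with
  | Ascii b0 b1 b2 b3 b4 b5 b6 b7 =>
      scott 1 0 (map enc_bool [b0; b1; b2; b3; b4; b5; b6; b7])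
  end.

Fixpoint enc_list (us : list lterm) : lterm :=
  match us with
  | [] => scott 2 0 []
  | u :: us' => scott 2 1 [u; enc_list us']
  end.

Definition enc_label (l : label) : lterm :=
  enc_list (map enc_ascii (list_ascii_of_string l)).

Fixpoint enc_phrase (e : phrase) : lterm :=
  match e with
  | Hole h => match h with end
  | Mixin ms => scott 6 0 [enc_list (map enc_phrase ms)]
  | Def l m => scott 6 1 [enc_label l; enc_phrase m]
  | Ref l null ls =>
      scott 6 2 [enc_label l; enc_bool null; enc_list (map enc_label ls)]
  | Lam x m => scott 6 3 [enc_label x; enc_phrase m]
  | App m1 m2 => scott 6 4 [enc_phrase m1; enc_phrase m2]
  | Var x => scott 6 5 [enc_label x]
  end.

Definition recursive_on (D : phrase -> Prop) (E : phrase -> phrase) : Prop :=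
  exists t, lbound 0 t /\
    forall e, D e -> lsteps (Ap t (enc_phrase e)) (enc_phrase (E e)).

(** * Macro-expressibility *)

(* [E] is the translation, [A] gives the syntactic abstraction of each symbol
   of a construct in [F]. *)
Record macro_translation (L F : language)
    (E : phrase -> phrase) (A : symbol -> context) : Prop := {
  macro_recursive : recursive_on (phrase_of (plus L F)) E;
  macro_phrases : forall e, phrase_of (plus L F) e -> phrase_of L (E e);
  macro_programs : forall P, program (plus L F) P -> program L (E P);
  macro_homomorphic : forall e, phrase_of (plus L F) e ->
    L (construct_of (symbol_of e)) -> ~ F (construct_of (symbol_of e)) ->
    E e = map_subexpressions E e;
  macro_eval : forall P, program (plus L F) P -> (eval P <-> eval (E P));
  macro_contexts : forall s, F (construct_of s) -> context_of L (arity s) (A s);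
  macro_abstraction : forall e, phrase_of (plus L F) e ->
    F (construct_of (symbol_of e)) ->
    E e = fill (A (symbol_of e)) (map E (subexpressions e))
}.

Definition macro_expresses (L F : language) : Prop :=
  exists E A, macro_translation L F E A.

(* Main.v *)
Require Import Defs.
From Stdlib Require Import Lia.

(** The translation of the universe to inheritance-calculus is compositional,
    computable and idempotent, so it is a macro translation of any set of
    constructs into inheritance-calculus.

    In the lazy lambda-calculus, [M N] converges only if [M] does.  This already
    holds at the level of documents: a closed [M] behaves below [__callee] as it
    does at the root, convergence of [M N] needs a [__result] in the [__whnf] of
    [M], and in the image of a lambda-term a [__result] always comes with a
    [__parameter].  With mixins and definitions added, one can write a [__whnf]
    with a [__result] but no [__parameter]: this body diverges but converges
    when applied.  A translation that preserves applications cannot eliminate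
    it. *)

(** * Structural properties of the translation *)

(** The generated principle gives no hypothesis for the members of a list, hence this recursion with
    an inner induction on the list. *)
Lemma term_nested_ind {H} (P : term H -> Prop)
    (hole : forall h, P (Hole h))
    (mixin : forall ms, Forall P ms -> P (Mixin ms))
    (def : forall l m, P m -> P (Def l m))
    (ref : forall l null ls, P (Ref l null ls))
    (lam : forall x m, P m -> P (Lam x m))
    (app : forall m1 m2, P m1 -> P m2 -> P (App m1 m2))
    (var : forall x, P (Var x)) :
  forall e, P e.
Proof.
  fix IH 1; intros [h | ms | l m | l null ls | x m | m1 m2 | x].
  - apply hole.
  - apply mixin. induction ms; constructor; [apply IH | assumption].
  - apply def, IH.
  - apply ref.
  - apply lam, IH.
  - apply app; apply IH.
  - apply var.
Qed.

(** Images of lambda-constructs are built from mixins, definitions and references, which [translate]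
    leaves in place. Hence a phrase and its image yield the same document, and evaluation agrees on
    them. *)
Lemma translate_idempotent {H} (e : term H) :
  translate (translate e) = translate e.
Proof.
  induction e as [h | ms IH | l m IH | | x m IH | m1 m2 IH1 IH2 |] using term_nested_ind;
    simpl; try congruence.
  f_equal. rewrite map_map. apply map_ext_in. now apply Forall_forall.
Qed.

Lemma sorted_translate {H} (s : sort) (e : term H) :
  sorted s e = true -> sorted s (translate e) = true.
Proof.
  revert s.
  induction e as [h | ms IH | l m IH | | x m IH | m1 m2 IH1 IH2 |] using term_nested_ind;
    simpl; intros s Hs; rewrite ?andb_true_iff in *; auto.
  - destruct Hs as [Hs Hms]. split; auto.
    rewrite forallb_forall in *. intros e' He'.
    apply in_map_iff in He'. destruct He' as [e [<- He]].
    rewrite Forall_forall in IH. auto.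
  - destruct Hs; auto.
  - destruct Hs as [[Hs Hx] Hm]. rewrite (IH _ Hm); auto.
  - destruct Hs as [[Hs H1] H2]. rewrite (IH1 _ H1), (IH2 _ H2); auto.
  - destruct Hs; auto.
Qed.

Lemma constructs_translate {H} (e : term H) (k : construct) :
  In k (constructs (translate e)) -> inheritance_calculus k.
Proof.
  unfold inheritance_calculus.
  induction e as [h | ms IH | l m IH | | x m IH | m1 m2 IH1 IH2 |] using term_nested_ind;
    simpl in *; rewrite ?app_nil_r, ?in_app_iff; simpl; try tauto.
  - intros [<- | Hk]; auto.
    rewrite Forall_forall in IH. rewrite flat_map_concat_map, map_map in Hk.
    apply in_concat in Hk. destruct Hk as [ks [Hks Hk]].
    apply in_map_iff in Hks. destruct Hks as [e [<- He]]. eauto.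
  - rewrite !in_app_iff; simpl. tauto.
Qed.

Lemma phrase_of_translate (L : language) (e : phrase) :
  phrase_of L e -> phrase_of inheritance_calculus (translate e).
Proof.
  intros [[s Hs] _]. split.
  - exists s. now apply sorted_translate.
  - apply constructs_translate.
Qed.

(** * Computability of the translation *)

Lemma lsteps_trans s t u : lsteps s t -> lsteps t u -> lsteps s u.
Proof. induction 1; eauto using lsteps. Qed.

Lemma lsteps_one s t : lstep s t -> lsteps s t.
Proof. eauto using lsteps. Qed.

Lemma lsteps_app s s' t t' :
  lsteps s s' -> lsteps t t' -> lsteps (Ap s t) (Ap s' t').
Proof.
  intros Hs Ht. apply lsteps_trans with (Ap s' t).
  - induction Hs; eauto using lsteps, lstep.
  - induction Ht; eauto using lsteps, lstep.
Qed.

Lemma lbound_weaken s k k' : lbound k s -> k <= k' -> lbound k' s.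
Proof.
  revert k k'; induction s as [n | s1 IH1 s2 IH2 | s IH]; simpl; intros k k' Hs Hk.
  - lia.
  - destruct Hs; eauto.
  - apply (IH (S k)); auto; lia.
Qed.

Lemma lsubst_bound s k k' u : lbound k s -> k <= k' -> lsubst s k' u = s.
Proof.
  revert k k'; induction s as [n | s1 IH1 s2 IH2 | s IH]; simpl; intros k k' Hs Hk.
  - destruct (Nat.eqb_spec n k'); auto; lia.
  - destruct Hs; f_equal; eauto.
  - f_equal. apply (IH (S k)); auto; lia.
Qed.

(** * Closed values and Scott encodings *)

(** Beta fires only when the argument is an abstraction, and substitution leaves closed terms
    unchanged; encodings have both properties. *)
Definition closed_value (s : lterm) : Prop :=
  lbound 0 s /\ exists s', s = Ab s'.

Lemma lsubst_value s k u : closed_value s -> lsubst s k u = s.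
Proof. intros [Hs _]. apply lsubst_bound with 0; auto; lia. Qed.

Lemma lbound_value s k : closed_value s -> lbound k s.
Proof. intros [Hs _]. apply lbound_weaken with 0; auto; lia. Qed.

Lemma beta s t : closed_value t -> lsteps (Ap (Ab s) t) (lsubst s 0 t).
Proof. intros [_ [t' ->]]. apply lsteps_one, lstep_beta. Qed.

Lemma scott_value n i us :
  i < n -> Forall closed_value us -> closed_value (scott n i us).
Proof.
  intros Hi Hus. unfold scott.
  set (b := fold_left Ap us (Ix (n - S i))).
  assert (Hb : lbound n b).
  { assert (H0 : lbound n (Ix (n - S i))) by (simpl; lia).
    subst b. revert H0. generalize (Ix (n - S i)).
    induction Hus as [| u us Hu _ IH]; simpl; auto.
    intros s Hs. apply IH. simpl. auto using lbound_value. }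
  clearbody b. split.
  (* The number of admissible free indices is generalised, since it grows as the binders are peeled
     off. *)
  - revert Hb. rewrite <- (Nat.add_0_r n) at 1. generalize 0.
    clear. induction n as [| n IH]; intros k Hb; simpl in *; auto.
    apply IH. now rewrite Nat.add_succ_r.
  - destruct n as [| n]; [lia |]. simpl. eauto.
Qed.

Lemma enc_bool_value b : closed_value (enc_bool b).
Proof. apply scott_value; auto. destruct b; lia. Qed.

Lemma enc_ascii_value a : closed_value (enc_ascii a).
Proof.
  destruct a. apply scott_value; [lia |].
  repeat apply Forall_cons; auto using Forall_nil, enc_bool_value.
Qed.

Lemma enc_list_value us : Forall closed_value us -> closed_value (enc_list us).
Proof. induction 1; apply scott_value; auto using Forall_cons, Forall_nil. Qed.

Lemma enc_label_value l : closed_value (enc_label l).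
Proof.
  apply enc_list_value, Forall_map, Forall_forall. intros. apply enc_ascii_value.
Qed.

Lemma enc_labels_value ls : closed_value (enc_list (map enc_label ls)).
Proof.
  apply enc_list_value, Forall_map, Forall_forall. intros. apply enc_label_value.
Qed.

Lemma enc_phrase_value e : closed_value (enc_phrase e).
Proof.
  induction e as [[] | ms IH | | | | |] using term_nested_ind;
    apply scott_value; try lia;
    repeat apply Forall_cons;
    auto using Forall_nil, enc_label_value, enc_bool_value, enc_labels_value.
  apply enc_list_value. now apply Forall_map.
Qed.

Lemma enc_phrases_value ms : closed_value (enc_list (map enc_phrase ms)).
Proof.
  apply enc_list_value, Forall_map, Forall_forall. intros. apply enc_phrase_value.
Qed.

(** * Iterated beta-reduction and case analysis *)

(** The first argument belongs to the outermost remaining binder, whose index in the body is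
    [length us']. *)
Fixpoint instantiate (s : lterm) (us : list lterm) : lterm :=
  match us with
  | [] => s
  | u :: us' => instantiate (lsubst s (length us') u) us'
  end.

Lemma lsteps_fold_left us s s' :
  lsteps s s' -> lsteps (fold_left Ap us s) (fold_left Ap us s').
Proof.
  revert s s'; induction us as [| u us IH]; simpl; auto.
  intros s s' Hs. apply IH, lsteps_app; auto using lsteps_refl.
Qed.

Lemma lsubst_iter n s k u :
  lsubst (Nat.iter n Ab s) k u = Nat.iter n Ab (lsubst s (n + k) u).
Proof.
  revert k; induction n as [| n IH]; simpl; intros k; auto.
  now rewrite IH, Nat.add_succ_r.
Qed.

Lemma beta_many s us :
  Forall closed_value us ->
  lsteps (fold_left Ap us (Nat.iter (length us) Ab s)) (instantiate s us).
Proof.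
  intros Hus. revert s; induction Hus as [| u us Hu _ IH]; simpl; intros s.
  - apply lsteps_refl.
  - apply lsteps_trans with (2 := IH _).
    apply lsteps_fold_left. apply lsteps_trans with (1 := beta _ _ Hu).
    rewrite lsubst_iter, Nat.add_0_r. apply lsteps_refl.
Qed.

Lemma lsubst_fold_left us s k u :
  Forall closed_value us ->
  lsubst (fold_left Ap us s) k u = fold_left Ap us (lsubst s k u).
Proof.
  intros Hus; revert s; induction Hus as [| v us Hv _ IH]; simpl; intros s; auto.
  rewrite IH; simpl. now rewrite (lsubst_value v).
Qed.

Lemma instantiate_fold_left us s cs :
  Forall closed_value us ->
  instantiate (fold_left Ap us s) cs = fold_left Ap us (instantiate s cs).
Proof.
  intros Hus; revert s; induction cs as [| c cs IH]; simpl; intros s; auto.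
  now rewrite lsubst_fold_left.
Qed.

Lemma instantiate_value c cs : closed_value c -> instantiate c cs = c.
Proof.
  intros Hc; induction cs as [| d cs IH]; simpl; auto. now rewrite lsubst_value.
Qed.

Lemma instantiate_nth cs i d :
  Forall closed_value cs -> i < length cs ->
  instantiate (Ix (length cs - S i)) cs = nth i cs d.
Proof.
  intros Hcs; revert i; induction Hcs as [| c cs Hc _ IH]; intros i Hi.
  - simpl in Hi; lia.
  - cbn [instantiate lsubst length].
    destruct i as [| i]; destruct (Nat.eqb_spec (S (length cs) - S 0) (length cs)); simpl in *.
    + now apply instantiate_value.
    + lia.
    + destruct (Nat.eqb_spec (length cs - S i) (length cs)); [lia |].
      apply IH; lia.
    + lia.
Qed.

(** This is case analysis on encoded data: [cs] are the branches and [us] the constructor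
    arguments. *)
Lemma scott_select cs i us d :
  Forall closed_value cs -> Forall closed_value us -> i < length cs ->
  lsteps (fold_left Ap cs (scott (length cs) i us)) (fold_left Ap us (nth i cs d)).
Proof.
  intros Hcs Hus Hi. unfold scott.
  apply lsteps_trans with (1 := beta_many _ _ Hcs).
  rewrite instantiate_fold_left, (instantiate_nth cs i d) by assumption.
  apply lsteps_refl.
Qed.

(** * The translation as a term of L *)

(** In these constructor functions, argument indices are shifted past the binders of the encoding:
    two for lists, six for phrases. *)
Definition lcons : lterm := Ab (Ab (scott 2 1 [Ix 3; Ix 2])).
Definition lmixin : lterm := Ab (scott 6 0 [Ix 6]).
Definition ldef : lterm := Ab (Ab (scott 6 1 [Ix 7; Ix 6])).
Definition lref : lterm := Ab (Ab (Ab (scott 6 2 [Ix 8; Ix 7; Ix 6]))).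

(* Recursion is self-application: [lmap lmap f us]. *)
Definition lmap : lterm :=
  Ab (Ab (Ab (Ap (Ap (Ix 0) (enc_list []))
    (Ab (Ab (Ap (Ap lcons (Ap (Ix 3) (Ix 1)))
                (Ap (Ap (Ap (Ix 4) (Ix 4)) (Ix 3)) (Ix 0)))))))).

(* [rec k] stands for the translation function below [k] binders. *)
Definition translate_mixin (rec : nat -> lterm) : lterm :=
  Ab (Ap lmixin (Ap (Ap (Ap lmap lmap) (rec 1)) (Ix 0))).

Definition translate_def (rec : nat -> lterm) : lterm :=
  Ab (Ab (Ap (Ap ldef (Ix 1)) (Ap (rec 2) (Ix 0)))).

Definition translate_lam (rec : nat -> lterm) : lterm :=
  Ab (Ab (Ap lmixin (Ap (Ap lcons
    (Ap (Ap ldef (enc_label whnf)) (Ap lmixin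
      (Ap (Ap lcons (Ap (Ap ldef (Ix 1)) (enc_phrase (Mixin [Ref parameter false []]))))
      (Ap (Ap lcons (enc_phrase (Def parameter (Mixin []))))
      (Ap (Ap lcons (Ap (Ap ldef (enc_label result)) (Ap (rec 2) (Ix 0))))
          (enc_list [])))))))
    (enc_list [])))).

Definition translate_app (rec : nat -> lterm) : lterm :=
  Ab (Ab (Ap lmixin
    (Ap (Ap lcons (Ap (Ap ldef (enc_label callee)) (Ap (rec 2) (Ix 1))))
    (Ap (Ap lcons (Ap (Ap ldef (enc_label call)) (Ap lmixin
       (Ap (Ap lcons (enc_phrase (Ref callee false [whnf])))
       (Ap (Ap lcons (Ap (Ap ldef (enc_label parameter)) (Ap (rec 2) (Ix 0))))
           (enc_list []))))))
    (Ap (Ap lcons (enc_phrase (Def whnf (Mixin [Ref call false [result; whnf]]))))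
        (enc_list [])))))).

Definition translate_var : lterm :=
  Ab (Ap lmixin (Ap (Ap lcons (Ap (Ap (Ap lref (Ix 0)) (enc_bool false)) (enc_list [])))
                    (enc_list []))).

Definition translate_body (rec : nat -> lterm) : lterm :=
  Ab (fold_left Ap
    [translate_mixin rec; translate_def rec; lref;
     translate_lam rec; translate_app rec; translate_var] (Ix 0)).

(** The index [S k] reaches past the [k] binders of a branch and the binder of the phrase, to the
    copy of the function passed to itself. *)
Definition translate_self : lterm :=
  Ab (translate_body (fun k => Ap (Ix (S k)) (Ix (S k)))).

(** One unfolding of the self-application. It is an abstraction, so it can be passed to [lmap] as a
    value. *)
Definition ltranslate : lterm :=
  translate_body (fun _ => Ap translate_self translate_self).

(** * Correctness of the term *)

Lemma translate_self_step : lsteps (Ap translate_self translate_self) ltranslate.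
Proof. apply lsteps_one. apply lstep_beta. Qed.

Ltac values :=
  repeat match goal with
         | |- Forall _ [] => apply Forall_nil
         | |- Forall _ (_ :: _) => apply Forall_cons
         end;
  auto using enc_label_value, enc_labels_value, enc_bool_value, enc_phrase_value,
             enc_phrases_value, enc_list_value, Forall_nil, Forall_cons.

Ltac instantiates :=
  cbn [instantiate length lsubst Nat.eqb scott Nat.iter nat_rect fold_left nth map Nat.sub];
  repeat match goal with
         | |- context [lsubst ?s ?k ?u] => rewrite (lsubst_value s k u) by values
         end.

Lemma lcons_steps a b u us :
  closed_value u -> Forall closed_value us ->
  lsteps a u -> lsteps b (enc_list us) ->
  lsteps (Ap (Ap lcons a) b) (enc_list (u :: us)).
Proof.
  intros Hu Hus Ha Hb.
  apply lsteps_trans with (Ap (Ap lcons u) (enc_list us)).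
  { repeat apply lsteps_app; auto using lsteps_refl. }
  refine (lsteps_trans _ _ _ (beta_many _ [u; enc_list us] _) _); [values |].
  instantiates. apply lsteps_refl.
Qed.

Lemma lmixin_steps a ms :
  lsteps a (enc_list (map enc_phrase ms)) ->
  lsteps (Ap lmixin a) (enc_phrase (Mixin ms)).
Proof.
  intros Ha.
  apply lsteps_trans with (Ap lmixin (enc_list (map enc_phrase ms))).
  { apply lsteps_app; auto using lsteps_refl. }
  refine (lsteps_trans _ _ _ (beta_many _ [enc_list (map enc_phrase ms)] _) _); [values |].
  instantiates. apply lsteps_refl.
Qed.

Lemma ldef_steps a l m :
  lsteps a (enc_phrase m) ->
  lsteps (Ap (Ap ldef (enc_label l)) a) (enc_phrase (Def l m)).
Proof.
  intros Ha.
  apply lsteps_trans with (Ap (Ap ldef (enc_label l)) (enc_phrase m)).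
  { repeat apply lsteps_app; auto using lsteps_refl. }
  refine (lsteps_trans _ _ _ (beta_many _ [enc_label l; enc_phrase m] _) _); [values |].
  instantiates. apply lsteps_refl.
Qed.

Lemma lref_steps l null ls :
  lsteps (Ap (Ap (Ap lref (enc_label l)) (enc_bool null)) (enc_list (map enc_label ls)))
         (enc_phrase (Ref l null ls)).
Proof.
  refine (lsteps_trans _ _ _
    (beta_many _ [enc_label l; enc_bool null; enc_list (map enc_label ls)] _) _); [values |].
  instantiates. apply lsteps_refl.
Qed.

Ltac bounds :=
  cbn [lbound scott Nat.iter nat_rect fold_left Nat.sub];
  repeat match goal with |- _ /\ _ => split end; try lia; apply lbound_value; values.

Lemma lcons_value : closed_value lcons.
Proof. split; [unfold lcons; bounds | unfold lcons; eauto]. Qed.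

Lemma lmixin_value : closed_value lmixin.
Proof. split; [unfold lmixin; bounds | unfold lmixin; eauto]. Qed.

Lemma ldef_value : closed_value ldef.
Proof. split; [unfold ldef; bounds | unfold ldef; eauto]. Qed.

Lemma lref_value : closed_value lref.
Proof. split; [unfold lref; bounds | unfold lref; eauto]. Qed.

Lemma lmap_value : closed_value lmap.
Proof.
  split; [unfold lmap | unfold lmap; eauto].
  pose proof lcons_value. bounds.
Qed.

Lemma translate_self_value : closed_value translate_self.
Proof.
  split; [| unfold translate_self, translate_body; eauto].
  pose proof lcons_value. pose proof lmixin_value. pose proof ldef_value.
  pose proof lref_value. pose proof lmap_value.
  unfold translate_self, translate_body, translate_mixin, translate_def, translate_lam,
    translate_app, translate_var. bounds.
Qed.

Ltac branch_bounds :=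
  intros Hr; split; [| eexists; reflexivity];
  pose proof lcons_value; pose proof lmixin_value; pose proof ldef_value;
  pose proof lref_value; pose proof lmap_value;
  unfold translate_mixin, translate_def, translate_lam, translate_app, translate_var;
  cbn [lbound scott Nat.iter nat_rect fold_left Nat.sub];
  repeat match goal with |- _ /\ _ => split end; try lia;
  first [apply lbound_weaken with (1 := Hr); lia | apply lbound_value; values].

Lemma translate_mixin_value r : lbound 0 r -> closed_value (translate_mixin (fun _ => r)).
Proof. branch_bounds. Qed.

Lemma translate_def_value r : lbound 0 r -> closed_value (translate_def (fun _ => r)).
Proof. branch_bounds. Qed.

Lemma translate_lam_value r : lbound 0 r -> closed_value (translate_lam (fun _ => r)).
Proof. branch_bounds. Qed.

Lemma translate_app_value r : lbound 0 r -> closed_value (translate_app (fun _ => r)).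
Proof. branch_bounds. Qed.

Lemma translate_var_value : closed_value translate_var.
Proof. assert (Hr : lbound 0 lcons) by apply lcons_value. revert Hr. branch_bounds. Qed.

Lemma lmap_steps f us vs :
  closed_value f ->
  Forall2 (fun u v => closed_value u /\ closed_value v /\ lsteps (Ap f u) v) us vs ->
  lsteps (Ap (Ap (Ap lmap lmap) f) (enc_list us)) (enc_list vs).
Proof.
  pose proof lmap_value as Hmap. pose proof lcons_value as Hcons.
  intros Hf Huv.
  (* The cons branch must be a closed value to be passed to the encoded list. *)
  assert (Hc : closed_value
    (Ab (Ab (Ap (Ap lcons (Ap f (Ix 1))) (Ap (Ap (Ap lmap lmap) f) (Ix 0)))))).
  { split; [bounds | eauto]. }
  induction Huv as [| u v us vs [Hu [Hv Hs]] Huv IH].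
  - refine (lsteps_trans _ _ _ (beta_many _ [lmap; f; enc_list []] _) _); [values |].
    instantiates.
    refine (scott_select [enc_list []; _] 0 [] (Ix 0) _ _ _); values; simpl; lia.
  - assert (Hus : Forall closed_value us).
    { clear - Huv. induction Huv as [| ? ? ? ? [? _]]; constructor; auto. }
    assert (Hvs : Forall closed_value vs).
    { clear - Huv. induction Huv as [| ? ? ? ? [_ [? _]]]; constructor; auto. }
    refine (lsteps_trans _ _ _ (beta_many _ [lmap; f; enc_list (u :: us)] _) _); [values |].
    instantiates.
    refine (lsteps_trans _ _ _
      (scott_select [enc_list []; _] 1 [u; enc_list us] (Ix 0) _ _ _) _);
      [values | values | simpl; lia |].
    cbn [nth].
    refine (lsteps_trans _ _ _ (beta_many _ [u; enc_list us] _) _); [values |].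
    instantiates. now apply lcons_steps.
Qed.

Lemma ltranslate_value : closed_value ltranslate.
Proof.
  assert (Hr : lbound 0 (Ap translate_self translate_self)).
  { split; apply translate_self_value. }
  pose proof (translate_mixin_value _ Hr). pose proof (translate_def_value _ Hr).
  pose proof (translate_lam_value _ Hr). pose proof (translate_app_value _ Hr).
  pose proof translate_var_value. pose proof lref_value.
  split; [| unfold ltranslate, translate_body; eauto].
  unfold ltranslate, translate_body. bounds.
Qed.

(** The encoded phrase itself selects its branch among the six, so each case of the correctness
    proof begins here. *)
Lemma ltranslate_branch e i us :
  i < 6 -> Forall closed_value us -> enc_phrase e = scott 6 i us ->
  lsteps (Ap ltranslate (enc_phrase e))
    (fold_left Ap us (nth i
      [translate_mixin (fun _ => Ap translate_self translate_self);
       translate_def (fun _ => Ap translate_self translate_self); lref;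
       translate_lam (fun _ => Ap translate_self translate_self);
       translate_app (fun _ => Ap translate_self translate_self); translate_var] (Ix 0))).
Proof.
  assert (Hr : lbound 0 (Ap translate_self translate_self)).
  { split; apply translate_self_value. }
  pose proof (translate_mixin_value _ Hr). pose proof (translate_def_value _ Hr).
  pose proof (translate_lam_value _ Hr). pose proof (translate_app_value _ Hr).
  pose proof translate_var_value. pose proof lref_value.
  intros Hi Hus He.
  apply lsteps_trans with (1 := beta_many _ [_] (Forall_cons _ (enc_phrase_value e) (Forall_nil _))).
  rewrite He. cbn [instantiate length]. cbn [fold_left lsubst Nat.eqb].
  repeat rewrite lsubst_value by values.
  apply (scott_select [_; _; _; _; _; _]); values.
Qed.

Ltac phrases :=
  cbn [translate];
  repeat first
    [ apply lmixin_steps; cbn [map]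
    | apply lcons_steps; [values | values | |]
    | apply ldef_steps
    | apply (lref_steps _ _ [])
    | solve [auto]
    | apply lsteps_refl ].

Lemma ltranslate_steps e :
  lsteps (Ap ltranslate (enc_phrase e)) (enc_phrase (translate e)).
Proof.
  pose proof lcons_value. pose proof lmixin_value. pose proof ldef_value.
  pose proof lref_value. pose proof lmap_value. pose proof translate_self_value.
  pose proof ltranslate_value.
  assert (Hrec : forall m, lsteps (Ap ltranslate (enc_phrase m)) (enc_phrase (translate m)) ->
    lsteps (Ap (Ap translate_self translate_self) (enc_phrase m)) (enc_phrase (translate m))).
  { intros m Hm. apply lsteps_trans with (2 := Hm).
    apply lsteps_app; auto using translate_self_step, lsteps_refl. }
  induction e as [[] | ms IH | l m IH | l null ls | x m IH | m1 m2 IH1 IH2 | x]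
    using term_nested_ind.
  - refine (lsteps_trans _ _ _
      (ltranslate_branch (Mixin ms) 0 [enc_list (map enc_phrase ms)] _ _ eq_refl) _);
      [lia | values |].
    cbn [nth].
    refine (lsteps_trans _ _ _ (beta_many _ [enc_list (map enc_phrase ms)] _) _); [values |].
    instantiates. apply lmixin_steps.
    (* [lmap] takes a value, so the self-application is first unfolded to [ltranslate]. *)
    apply lsteps_trans with
      (Ap (Ap (Ap lmap lmap) ltranslate) (enc_list (map enc_phrase ms))).
    { repeat apply lsteps_app; auto using translate_self_step, lsteps_refl. }
    apply lmap_steps; auto.
    clear - IH. induction IH; constructor; auto using enc_phrase_value.
  - refine (lsteps_trans _ _ _
      (ltranslate_branch (Def l m) 1 [enc_label l; enc_phrase m] _ _ eq_refl) _);
      [lia | values |].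
    cbn [nth].
    refine (lsteps_trans _ _ _ (beta_many _ [enc_label l; enc_phrase m] _) _); [values |].
    instantiates. apply ldef_steps; auto.
  - refine (lsteps_trans _ _ _ (ltranslate_branch (Ref l null ls) 2
      [enc_label l; enc_bool null; enc_list (map enc_label ls)] _ _ eq_refl) _);
      [lia | values |].
    apply lref_steps.
  - refine (lsteps_trans _ _ _
      (ltranslate_branch (Lam x m) 3 [enc_label x; enc_phrase m] _ _ eq_refl) _);
      [lia | values |].
    cbn [nth].
    refine (lsteps_trans _ _ _ (beta_many _ [enc_label x; enc_phrase m] _) _); [values |].
    instantiates.
    phrases.
  - refine (lsteps_trans _ _ _
      (ltranslate_branch (App m1 m2) 4 [enc_phrase m1; enc_phrase m2] _ _ eq_refl) _);
      [lia | values |].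
    cbn [nth].
    refine (lsteps_trans _ _ _ (beta_many _ [enc_phrase m1; enc_phrase m2] _) _); [values |].
    instantiates.
    phrases.
  - refine (lsteps_trans _ _ _
      (ltranslate_branch (Var x) 5 [enc_label x] _ _ eq_refl) _);
      [lia | values |].
    cbn [nth].
    refine (lsteps_trans _ _ _ (beta_many _ [enc_label x] _) _); [values |].
    instantiates.
    phrases.
Qed.

Lemma translate_recursive D : recursive_on D translate.
Proof.
  exists ltranslate. split.
  - apply ltranslate_value.
  - intros e _. apply ltranslate_steps.
Qed.

(** * Inheritance-calculus macro-expresses every construct *)

(** [translate] keeps holes, so on a lambda-construct over holes it gives the context that replaces
    it. The other constructs get the context that rebuilds them, since [F] may contain them too. *)
Definition abstraction (s : symbol) : context :=
  match s with
  | SMixin n => Mixin (map Hole (seq 0 n))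
  | SDef l => Def l (Hole 0)
  | SRef l null ls => Ref l null ls
  | SLam x => translate (Lam x (Hole 0))
  | SApp => translate (App (Hole 0) (Hole 1))
  | SVar x => translate (Var x)
  end.

Lemma map_nth_seq {A} (d : A) (us : list A) :
  map (fun i => nth i us d) (seq 0 (length us)) = us.
Proof.
  induction us as [| u us IH]; simpl; auto.
  rewrite <- seq_shift, map_map. now f_equal.
Qed.

Lemma abstraction_context_of (s : symbol) :
  context_of inheritance_calculus (arity s) (abstraction s).
Proof.
  split; [split |].
  - exists (match s with SDef _ | SRef _ _ _ => Member | _ => Body end).
    destruct s; simpl; auto.
    generalize 0; induction n; simpl; auto.
  - intros k. destruct s; try apply constructs_translate.
    + simpl. intros [<- | Hk].
      * now left.
      * exfalso. revert Hk. generalize 0; induction n; simpl; eauto.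
    + simpl. intros [<- | []]. right; now left.
    + simpl. intros [<- | []]. right; right; now left.
  - intros i. destruct s; simpl; try lia.
    intros Hi. apply in_flat_map in Hi. destruct Hi as [C [HC Hi]].
    apply in_map_iff in HC. destruct HC as [j [<- Hj]].
    apply in_seq in Hj. destruct Hi as [<- | []]. lia.
Qed.

Lemma translate_abstraction (e : phrase) :
  translate e = fill (abstraction (symbol_of e)) (map translate (subexpressions e)).
Proof.
  destruct e as [[] | ms | | | | |]; simpl; auto.
  rewrite map_map. f_equal; simpl.
  rewrite <- (length_map translate). symmetry. apply map_nth_seq.
Qed.

(** [translate] rebuilds mixins, definitions and references and replaces lambda-constructs by fixed
    contexts, so the conditions hold whichever constructs [F] selects. Evaluation is preserved
    because [eval] translates first and translating twice changes nothing more. *)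
Theorem inheritance_calculus_macro_expresses (F : construct -> Prop) :
  macro_expresses inheritance_calculus F.
Proof.
  exists translate, abstraction. split.
  - apply translate_recursive.
  - apply phrase_of_translate.
  - intros P [HP [Hs Hw]]. split; [| split].
    + eapply phrase_of_translate; eauto.
    + now apply sorted_translate.
    + now rewrite translate_idempotent.
  - intros e _ Hk _. destruct e; auto; exfalso;
      unfold inheritance_calculus in Hk; simpl in Hk; intuition discriminate.
  - intros P _. unfold eval. now rewrite translate_idempotent.
  - intros s _. apply abstraction_context_of.
  - intros e _ _. apply translate_abstraction.
Qed.

(** * Closed subdocuments *)

(** Without a null marker the label list of an indexed reference begins with the label searched for,
    so it is nonempty and no base is the root of the subdocument. *)
Definition no_null (doc : phrase) : Prop :=
  forall p ms l null ls,
    at_path doc p = Some (Mixin ms) -> In (Ref l null ls) ms -> null = false.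

Scheme supers_mind := Minimality for supers Sort Prop
with overrides_mind := Minimality for overrides Sort Prop
with bases_mind := Minimality for bases Sort Prop
with bases_star_mind := Minimality for bases_star Sort Prop
with resolve_mind := Minimality for resolve Sort Prop
with this_mind := Minimality for this Sort Prop.

Combined Scheme semantics_mind from
  supers_mind, overrides_mind, bases_mind, bases_star_mind, resolve_mind, this_mind.

Lemma overrides_nonempty_supers doc l p o :
  overrides doc (l :: p) o -> supers doc (l :: p) p o.
Proof. intros Ho. econstructor; eauto. constructor. Qed.

(** The first step of a nonempty chain is a base, and a base arises from an override of the path
    where it starts. *)
Lemma bases_star_overrides doc l p q o :
  bases_star doc (l :: p) q -> overrides doc q o -> exists o', overrides doc (l :: p) o'.
Proof.
  intros Hb Ho. inversion Hb as [| ? q' ? Hq]; subst; eauto.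
  inversion Hq; subst; eauto.
Qed.

Section Subdocument.

Variables (doc sub : phrase) (a : label).
Hypothesis at_sub : at_path doc [a] = Some sub.
Hypothesis sub_closed : well_formed sub.
Hypothesis sub_no_null : no_null sub.

Lemma at_path_sub q : at_path doc (q ++ [a]) = at_path sub q.
Proof using at_sub.
  induction q as [| l q IH]; [exact at_sub |].
  cbn [app at_path]. now rewrite IH.
Qed.

Lemma has_sub q l : has doc (q ++ [a]) l = has sub q l.
Proof using at_sub. unfold has. now rewrite at_path_sub. Qed.

(** A climb that succeeds inside [sub] inspects only mixins of [sub], which are the same in
    [doc]. *)
Lemma lexical_sub q l n : lexical sub q l = Some n ->
  lexical doc (q ++ [a]) l = Some n /\ n <= length q.
Proof using at_sub.
  revert n; induction q as [| b q IH]; intros n; cbn [lexical app].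
  - replace (has doc [a] l) with (has sub [] l) by (symmetry; apply (has_sub [])).
    destruct (has sub [] l); [| discriminate].
    intros Hn; injection Hn as <-. auto.
  - rewrite <- (has_sub (b :: q)). cbn [app].
    destruct (has doc (b :: q ++ [a]) l).
    + intros Hn; injection Hn as <-. split; auto; lia.
    + destruct (lexical sub q l) as [m |]; [| discriminate].
      intros Hn; injection Hn as <-.
      destruct (IH m eq_refl) as [-> Hm]. simpl. split; auto; lia.
Qed.

Lemma inherits_sub q n w :
  inherits doc (q ++ [a]) n w ->
  exists l e, q = l :: e /\ n <= length e /\ inherits sub q n w /\ w <> [].
Proof using at_sub sub_closed sub_no_null.
  intros [Hdom [ms [l [null [ls [Hat [Hin Hix]]]]]]].
  rewrite at_path_sub in Hat.
  assert (null = false) as -> by eauto.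
  destruct (sub_closed q ms Hat) as [_ Hwf]. specialize (Hwf _ _ _ Hin).
  (* A reference at the root of [sub] has no index, so well-formedness rules it out. *)
  destruct q as [| b e]; [now contradict Hwf |].
  exists b, e. cbn [index app] in Hix, Hwf.
  destruct (lexical sub e l) as [m |] eqn:Hlex; [| now contradict Hwf].
  destruct (lexical_sub _ _ _ Hlex) as [Hdoc Hm]. rewrite Hdoc in Hix.
  injection Hix as <- <-. repeat split; auto; try discriminate.
  - cbn [in_dom app] in *. now rewrite <- has_sub.
  - exists ms, l, false, ls. repeat split; auto. cbn [index]. now rewrite Hlex.
Qed.

(* A super of the subdocument itself is read from the root of [doc] in [doc],
   but from the root of [sub] in [sub]: hence the disjunction on [i]. *)
Lemma semantics_sub :
  (forall s i o, supers doc s i o -> forall q, s = q ++ [a] ->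
     exists i' o', supers sub q i' o' /\ o = o' ++ [a] /\ (o' = [] \/ i = i' ++ [a])) /\
  (forall s o, overrides doc s o -> forall q, s = q ++ [a] ->
     exists o', overrides sub q o' /\ o = o' ++ [a]) /\
  (forall s t, bases doc s t -> forall q, s = q ++ [a] ->
     q <> [] /\ exists t', bases sub q t' /\ t = t' ++ [a] /\ t' <> []) /\
  (forall s t, bases_star doc s t -> forall q, s = q ++ [a] ->
     exists t', bases_star sub q t' /\ t = t' ++ [a] /\
       (q <> [] -> t' <> []) /\ (q = [] -> t' = [])) /\
  (forall s d n w t, resolve doc s d n w t -> forall q l e,
     s = q ++ [a] -> d = l :: e ++ [a] -> n <= length e -> w <> [] ->
     exists t', resolve sub q (l :: e) n w t' /\ t = t' ++ [a] /\ t' <> []) /\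
  (forall s d n u, this doc s d n u -> forall q e,
     s = q ++ [a] -> d = e ++ [a] -> n <= length e ->
     exists u', this sub q e n u' /\ u = u' ++ [a]).
Proof using at_sub sub_closed sub_no_null.
  apply semantics_mind.
  - intros q Hq. now destruct q.
  - intros p l l' i o _ IHb _ IHo q Hq.
    destruct (IHb _ Hq) as [t' [Hb [Ht [Hne He]]]].
    destruct (IHo _ Ht) as [o' [Ho ->]].
    (* If [t'] is empty, the base is the root of [sub] and the left side of the disjunction applies;
       otherwise removing the last label of the base keeps the suffix [[a]]. *)
    destruct t' as [| c t'].
    + destruct q; [| exfalso; apply Hne; congruence].
      exists [], o'. inversion Ho; subst. repeat split; auto. constructor.
    + injection Ht as -> ->. destruct q as [| b q]; [discriminate He; auto |].
      exists t', o'. repeat split; auto. econstructor; eauto.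
  - intros q Hq. now destruct q.
  - intros p l i b o Hs IHs Hdom Ho q Hq.
    destruct q as [| l' q].
    + injection Hq as -> ->. inversion Hs; subst. exists [].
      split; [constructor |]. now destruct Ho.
    + injection Hq as -> ->.
      destruct (IHs _ eq_refl) as [i' [b' [Hs' [-> Hi]]]].
      cbn [in_dom] in Hdom. rewrite has_sub in Hdom.
      destruct Ho as [-> | ->]; [exists (l' :: q) | exists (l' :: b')];
        (split; [econstructor; eauto | reflexivity]).
  - intros p l o n w t _ IHo Hinh _ IHr q Hq.
    destruct (IHo _ Hq) as [o' [Ho ->]].
    destruct (inherits_sub _ _ _ Hinh) as [c [e [-> [Hn [Hinh' Hw]]]]].
    (* The root of [sub] overrides only itself, and no reference is written there. *)
    destruct q as [| l' q].
    + inversion Ho.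
    + injection Hq as -> ->. split; [discriminate |].
      destruct (IHr _ _ _ eq_refl eq_refl Hn Hw) as [t' [Hr [-> Hne]]].
      exists t'. repeat split; auto. econstructor; eauto.
  - intros p q ->. exists q. repeat split; auto. constructor.
  - intros p q r _ IHb _ IHs q' Hq'.
    destruct (IHb _ Hq') as [Hne [t' [Hb [-> Ht']]]].
    destruct (IHs _ eq_refl) as [r' [Hs [-> [Hr' _]]]].
    exists r'. repeat split; auto; [econstructor; eauto | congruence].
  - intros s l d n w c _ IHt q l' e -> Hd Hn Hw. injection Hd as -> ->.
    destruct (IHt _ _ eq_refl eq_refl Hn) as [u' [Ht ->]].
    exists (extend u' w). split; [constructor; auto |].
    unfold extend. split; [now rewrite app_assoc |].
    destruct w as [| l w]; [easy |]. simpl. now destruct (rev w).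
  - intros s d q e -> -> _. exists q. split; auto. constructor.
  - intros s l d n t u _ IHs _ IHt q e -> He Hn.
    (* A positive climb within the bound starts strictly below the root of [sub], which excludes the
       exceptional side of the disjunction. *)
    destruct e as [| l' e]; [simpl in Hn; lia |].
    injection He as -> ->.
    destruct (IHs _ eq_refl) as [i' [o' [Hs [Ho Hi]]]].
    change (l' :: e ++ [a]) with ((l' :: e) ++ [a]) in Ho.
    apply app_inv_tail in Ho. subst o'.
    destruct Hi as [Hi | ->]; [discriminate |].
    simpl in Hn.
    destruct (IHt _ _ eq_refl eq_refl ltac:(lia)) as [u' [Ht ->]].
    exists u'. split; auto. econstructor; eauto.
Qed.

End Subdocument.

(** * Images of lambda-terms *)

(** These are the two traits of images of lambda-terms that drive the argument: references climb
    lexically, and [__result] occurs only beside [__parameter]. *)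
Fixpoint regular (e : phrase) : bool :=
  match e with
  | Mixin ms =>
      forallb regular ms &&
      (negb (existsb (String.eqb result) (defined_labels ms)) ||
       existsb (String.eqb parameter) (defined_labels ms))
  | Def _ m => regular m
  | Ref _ null _ => negb null
  | _ => true
  end.

(** Only the image of an abstraction can define [__result], and it defines [__parameter] in the same
    mixin. *)
Lemma regular_translate (m : phrase) :
  (forall k, In k (constructs m) -> lazy_lambda_calculus k) ->
  regular (translate m) = true.
Proof.
  unfold lazy_lambda_calculus.
  induction m as [[] | ms | l m | l null ls | x m IH | m1 IH1 m2 IH2 | x]; intros Hm;
    try (specialize (Hm _ (or_introl eq_refl)); simpl in Hm; intuition discriminate).
  - cbn. rewrite IH by (intros k Hk; apply Hm; now right).
    cbn. now rewrite !orb_true_r.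
  - cbn.
    rewrite IH1 by (intros k Hk; apply Hm; simpl; rewrite in_app_iff; auto).
    now rewrite IH2 by (intros k Hk; apply Hm; simpl; rewrite in_app_iff; auto).
Qed.

Lemma in_definitions l m m' :
  In m' (definitions l m) -> exists ms, m = Mixin ms /\ In (Def l m') ms.
Proof.
  destruct m as [[] | ms | | | | |]; try easy.
  simpl. intros Hin. apply in_flat_map in Hin. destruct Hin as [e [He Hm']].
  destruct e as [[] | | l' m | | | |]; try easy.
  destruct (String.eqb_spec l' l) as [-> |]; [| easy].
  destruct Hm' as [-> | []]. eauto.
Qed.

Lemma definitions_defined l ms :
  definitions l (Mixin ms) <> [] <-> existsb (String.eqb l) (defined_labels ms) = true.
Proof.
  induction ms as [| e ms IH]; [easy |].
  destruct e as [[] | | l' m | | | |]; try exact IH.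
  simpl in *. rewrite String.eqb_sym.
  destruct (String.eqb l l'); simpl; [easy | exact IH].
Qed.

Lemma at_path_cons doc l p m :
  at_path doc (l :: p) = Some m ->
  exists ms, at_path doc p = Some (Mixin ms) /\ definitions l (Mixin ms) = [m].
Proof.
  simpl. destruct (at_path doc p) as [m0 |]; [| easy].
  destruct (definitions l m0) as [| m1 [|]] eqn:Hdef; try easy.
  intros Hm; injection Hm as ->.
  destruct (in_definitions l m0 m) as [ms [-> _]]; [rewrite Hdef; now left |].
  eauto.
Qed.

Lemma regular_at_path doc p m :
  regular doc = true -> at_path doc p = Some m -> regular m = true.
Proof.
  intros Hdoc; revert m; induction p as [| l p IH]; intros m Hm.
  - now injection Hm as <-.
  - destruct (at_path_cons _ _ _ _ Hm) as [ms [Hms Hdef]].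
    specialize (IH _ Hms). simpl in IH. apply andb_true_iff in IH. destruct IH as [IH _].
    rewrite forallb_forall in IH.
    destruct (in_definitions l (Mixin ms) m) as [ms' [Heq Hin]]; [rewrite Hdef; now left |].
    injection Heq as ->. exact (IH _ Hin).
Qed.

Lemma regular_no_null doc : regular doc = true -> no_null doc.
Proof.
  intros Hdoc p ms l null ls Hms Hin.
  pose proof (regular_at_path _ _ _ Hdoc Hms) as Hreg.
  simpl in Hreg. apply andb_true_iff in Hreg. destruct Hreg as [Hreg _].
  rewrite forallb_forall in Hreg. apply Hreg in Hin. now destruct null.
Qed.

Lemma regular_has_parameter doc p :
  regular doc = true -> has doc p result = true -> has doc p parameter = true.
Proof.
  unfold has. intros Hdoc.
  destruct (at_path doc p) as [m |] eqn:Hm; [| easy].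
  pose proof (regular_at_path _ _ _ Hdoc Hm) as Hreg. clear Hm.
  destruct m as [[] | ms | | | | |]; try easy.
  pose proof (definitions_defined result ms) as [Hres _].
  pose proof (definitions_defined parameter ms) as [_ Hpar].
  cbn [regular] in Hreg. apply andb_true_iff in Hreg. destruct Hreg as [_ Hreg].
  destruct (definitions result (Mixin ms)); [easy |].
  rewrite Hres in Hreg by easy. apply Hpar in Hreg.
  now destruct (definitions parameter (Mixin ms)).
Qed.

(** * Supers of top-level labels *)

(** The root is its own only super, so both alternatives for an override coincide. *)
Lemma overrides_top doc l o : overrides doc [l] o -> o = [l].
Proof.
  intros Ho. inversion Ho as [| ? ? ? ? ? Hs _ Ho']; subst.
  inversion Hs; subst. now destruct Ho'.
Qed.

(** A reference written one level below the root can only climb zero steps, so its labels are read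
    from the root; [rev] turns reading order into path order. *)
Lemma bases_top doc l t :
  bases doc [l] t -> exists n w, inherits doc [l] n w /\ t = rev w.
Proof.
  intros Hb. inversion Hb as [? ? o n w ? Ho Hi Hr]; subst.
  apply overrides_top in Ho; subst. exists n, w. split; auto.
  inversion Hr as [? ? ? ? ? c Ht]; subst. inversion Ht; subst.
  apply app_nil_r.
Qed.

(** With [overrides_nonempty_supers], this reduces convergence to finding a definition of
    [__parameter] in some super of [__whnf]. *)
Lemma supers_overrides doc l p i o :
  supers doc (l :: p) i o -> exists o', overrides doc (l :: p) o'.
Proof. intros Hs. inversion Hs; subst. eauto using bases_star_overrides. Qed.

Lemma overrides_inv doc l p o :
  overrides doc (l :: p) o -> exists i b, supers doc p i b /\ has doc b l = true.
Proof. intros Ho. inversion Ho; subst. eauto. Qed.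

(** Splitting off the first base leaves either the mixin itself or the target of a reference written
    in it. The condition on [rev w] is there because supers of the root do not come from chains of
    bases. *)
Lemma supers_top doc l i b :
  supers doc [l] i b ->
  b = [l] \/
  exists n w, inherits doc [l] n w /\ (rev w <> [] -> supers doc (rev w) i b).
Proof.
  intros Hs. inversion Hs as [| ? ? l' ? ? Hb Ho]; subst.
  inversion Hb as [| ? q ? Hq Hq']; subst.
  - left. now apply overrides_top with doc.
  - right. apply bases_top in Hq. destruct Hq as [n [w [Hi ->]]].
    exists n, w. split; auto. intros Hw.
    destruct (rev w) as [| c r]; [easy |]. econstructor; eauto.
Qed.

(** * Application and its callee *)

Section Application.

Variables (m n : phrase).

Lemma inherits_call k w :
  inherits (translate (App m n)) [call] k w -> w = [callee; whnf].
Proof.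
  intros [_ [ms [l [null [ls [Hms [Hin Hix]]]]]]].
  cbn in Hms. injection Hms as <-.
  destruct Hin as [Hin | [Hin | []]]; [| discriminate].
  injection Hin as <- <- <-. cbn in Hix. now injection Hix as _ <-.
Qed.

Lemma inherits_whnf k w :
  inherits (translate (App m n)) [whnf] k w -> w = [call; result; whnf].
Proof.
  intros [_ [ms [l [null [ls [Hms [Hin Hix]]]]]]].
  cbn in Hms. injection Hms as <-.
  destruct Hin as [Hin | []].
  injection Hin as <- <- <-. cbn in Hix. now injection Hix as _ <-.
Qed.

(* The callee must produce a mixin with a result, which in the image of a
   lambda-term also has a parameter. *)
Lemma eval_callee :
  program lazy_lambda_calculus m -> eval (App m n) -> eval m.
Proof.
  intros [[_ Hm] [_ Hwf]] [i [o Heval]]. unfold eval, converges in *.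
  pose proof (regular_translate m Hm) as Hreg.
  apply supers_overrides in Heval. destruct Heval as [o1 Heval].
  apply overrides_inv in Heval. destruct Heval as [i1 [b1 [Hs1 Hpar]]].
  (* The body of [__whnf] defines nothing, so [__parameter] comes through its reference to [__call],
     [__result], [__whnf]. *)
  apply supers_top in Hs1. destruct Hs1 as [-> | [k1 [w1 [Hi1 Hs1]]]]; [discriminate |].
  apply inherits_whnf in Hi1. subst w1.
  apply supers_overrides in Hs1; [| discriminate]. destruct Hs1 as [o2 Hs1].
  apply overrides_inv in Hs1. destruct Hs1 as [i2 [b2 [Hs2 _]]].
  apply supers_overrides in Hs2. destruct Hs2 as [o3 Hs2].
  apply overrides_inv in Hs2. destruct Hs2 as [i3 [b3 [Hs3 Hres]]].
  (* [__call] itself defines only [__parameter], so [__result] comes from the [__whnf] of the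
     callee. *)
  apply supers_top in Hs3. destruct Hs3 as [-> | [k3 [w3 [Hi3 Hs3]]]]; [discriminate |].
  apply inherits_call in Hi3. subst w3.
  specialize (Hs3 ltac:(discriminate)).
  (* The super found below [__callee] is also a super of [__whnf] in [translate m] alone, where
     regularity supplies a [__parameter]. *)
  destruct (semantics_sub (translate (App m n)) (translate m) callee eq_refl Hwf
              (regular_no_null _ Hreg)) as [Hsub _].
  destruct (Hsub _ _ _ Hs3 [whnf] eq_refl) as [i' [o' [Hs [-> _]]]].
  rewrite (has_sub (translate (App m n)) (translate m) callee eq_refl) in Hres.
  apply (regular_has_parameter _ _ Hreg) in Hres.
  exists [whnf], [parameter; whnf]. apply overrides_nonempty_supers.
  econstructor; eauto.
Qed.

End Application.

(** * Checking well-formedness by enumeration *)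

(** Well-formedness quantifies over all paths; a finite list of mixins with their paths lets it be
    checked by computation on concrete documents. *)
Fixpoint subdocuments (p : path) (m : phrase) : list (path * phrase) :=
  match m with
  | Mixin ms => (p, m) :: flat_map (subdocuments p) ms
  | Def l m' => subdocuments (l :: p) m'
  | _ => []
  end.

Lemma subdocuments_definition doc r q ms l m :
  In (q, Mixin ms) (subdocuments r doc) -> In (Def l m) ms ->
  incl (subdocuments (l :: q) m) (subdocuments r doc).
Proof.
  revert r.
  induction doc as [[] | ms' IH | l' m' IH | | | |] using term_nested_ind;
    intros r Hq Hm; try easy.
  - destruct Hq as [Heq | Hq].
    + injection Heq as <- ->. intros x Hx. right.
      apply in_flat_map. exists (Def l m). auto.
    + apply in_flat_map in Hq. destruct Hq as [e [He Hq]].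
      rewrite Forall_forall in IH. intros x Hx. right.
      apply in_flat_map. exists e. split; auto. now apply (IH e He).
  - simpl in *. now apply IH.
Qed.

Lemma at_path_subdocuments doc p ms :
  at_path doc p = Some (Mixin ms) -> In (p, Mixin ms) (subdocuments [] doc).
Proof.
  revert ms; induction p as [| l p IH]; intros ms Hp.
  - injection Hp as ->. now left.
  - destruct (at_path_cons _ _ _ _ Hp) as [ms' [Hms' Hdef]].
    destruct (in_definitions l (Mixin ms') (Mixin ms)) as [? [Heq Hin]];
      [rewrite Hdef; now left |].
    injection Heq as <-.
    apply (subdocuments_definition _ _ _ _ _ _ (IH _ Hms') Hin). now left.
Qed.

Lemma well_formed_subdocuments doc :
  Forall (fun pm =>
    match snd pm with
    | Mixin ms =>
        NoDup (defined_labels ms) /\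
        Forall (fun e => match e with
                         | Ref l null ls => index doc (fst pm) l null ls <> None
                         | _ => True
                         end) ms
    | _ => True
    end) (subdocuments [] doc) ->
  well_formed doc.
Proof.
  rewrite Forall_forall. intros Hdoc p ms Hp.
  destruct (Hdoc _ (at_path_subdocuments _ _ _ Hp)) as [Hdup Href].
  split; auto. intros l null ls Hin.
  rewrite Forall_forall in Href. exact (Href _ Hin).
Qed.

(* It diverges, yet converges once applied: [__whnf] has a result but no
   parameter. *)
Definition bare_result : phrase :=
  Mixin [Def whnf (Mixin [Def result (Mixin [Def whnf (Mixin [Def parameter (Mixin [])])])])].

Ltac check_well_formed :=
  apply well_formed_subdocuments;
  repeat first
    [ apply Forall_nil | apply Forall_cons | exact I | discriminate
    | apply NoDup_nil | apply NoDup_cons | split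
    | progress cbn [snd fst defined_labels flat_map app]
    | simpl; intuition discriminate ].

Lemma bare_result_program L : L CMixin -> L CDef -> program L bare_result.
Proof.
  intros HM HD. split; [| split].
  - split; [now exists Body |]. simpl. intuition subst; auto.
  - reflexivity.
  - cbn. check_well_formed.
Qed.

Lemma bare_result_application_program L :
  L CMixin -> L CDef -> L CApp -> program L (App bare_result (Mixin [])).
Proof.
  intros HM HD HA. split; [| split].
  - split; [now exists Body |]. simpl. intuition subst; auto.
  - reflexivity.
  - cbn. check_well_formed.
Qed.

(** The [__whnf] mixin defines only [__result] and contains no reference through which a
    [__parameter] could come. *)
Lemma bare_result_not_eval : ~ eval bare_result.
Proof.
  intros [i [o Heval]].
  apply supers_overrides in Heval. destruct Heval as [o1 Heval].
  apply overrides_inv in Heval. destruct Heval as [i1 [b1 [Hs1 Hpar]]].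
  apply supers_top in Hs1.
  destruct Hs1 as [-> | [n [w [[_ [ms [l [null [ls [Hms [Hin _]]]]]]] _]]]];
    [discriminate |].
  cbn in Hms. injection Hms as <-. now destruct Hin.
Qed.

(** [__call] inherits the [__result] of the callee's [__whnf]; the outer [__whnf] then inherits the
    [__whnf] inside that result, which defines [__parameter]. *)
Lemma bare_result_application_eval : eval (App bare_result (Mixin [])).
Proof.
  unfold eval. set (doc := translate _).
  assert (Htop : forall l, has doc [] l = true -> overrides doc [l] [l]).
  { intros l Hl. apply (overrides_step doc [] l [] []); auto. constructor. }
  assert (Hcallee : overrides doc [whnf; callee] [whnf; callee]).
  { apply (overrides_step doc [callee] whnf [] [callee]); auto.
    - now apply overrides_nonempty_supers, Htop.
    - reflexivity. }
  assert (Hcall : bases doc [call] [whnf; callee]).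
  (* The index is 0 because [__callee] is defined at the root, where the climb starts. *)
  { apply (bases_step doc [] call [call] 0 [callee; whnf]).
    - now apply Htop.
    - split; [reflexivity |]. do 4 eexists. split; [reflexivity |].
      split; [now left | reflexivity].
    - apply (resolve_intro doc [] call [] 0 [callee; whnf] []). constructor. }
  assert (Hresult : overrides doc [result; call] [result; whnf; callee]).
  { apply (overrides_step doc [call] result [callee] [whnf; callee]); auto; [| reflexivity].
    apply (supers_step doc [] call whnf); auto.
    eapply bases_star_step; [exact Hcall | constructor]. }
  assert (Hwhnf : bases doc [whnf] [whnf; result; call]).
  { apply (bases_step doc [] whnf [whnf] 0 [call; result; whnf]).
    - now apply Htop.
    - split; [reflexivity |]. do 4 eexists. split; [reflexivity |].
      split; [now left | reflexivity].
    - apply (resolve_intro doc [] whnf [] 0 [call; result; whnf] []). constructor. }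
  assert (Hvalue : overrides doc [whnf; result; call] [whnf; result; whnf; callee]).
  { apply (overrides_step doc [result; call] whnf [call] [result; whnf; callee]);
      auto; [| reflexivity].
    now apply overrides_nonempty_supers. }
  exists [whnf], [parameter; whnf]. apply overrides_nonempty_supers.
  apply (overrides_step doc [whnf] parameter [result; call] [whnf; result; whnf; callee]);
    auto; [| reflexivity].
  apply (supers_step doc [] whnf whnf); auto.
  eapply bases_star_step; [exact Hwhnf | constructor].
Qed.

(** * Failure of the converse *)

(** Application is outside this set of constructs, so the translation must keep it. Then
    [eval_callee] carries the convergence of the applied phrase back to its divergent callee. *)
Theorem lazy_lambda_calculus_not_macro_expresses :
  ~ macro_expresses lazy_lambda_calculus (fun k => k = CMixin \/ k = CDef).
Proof.
  intros [E [A HE]].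
  assert (HP : program (plus lazy_lambda_calculus (fun k => k = CMixin \/ k = CDef))
                 (App bare_result (Mixin []))).
  { apply bare_result_application_program; unfold plus, lazy_lambda_calculus; simpl; auto. }
  assert (HQ : program (plus lazy_lambda_calculus (fun k => k = CMixin \/ k = CDef))
                 bare_result).
  { apply bare_result_program; unfold plus; auto. }
  apply bare_result_not_eval, (macro_eval _ _ _ _ HE _ HQ).
  apply (eval_callee _ (E (Mixin []))); [exact (macro_programs _ _ _ _ HE _ HQ) |].
  assert (Happ : E (App bare_result (Mixin [])) = App (E bare_result) (E (Mixin []))).
  { apply (macro_homomorphic _ _ _ _ HE).
    - apply HP.
    - unfold lazy_lambda_calculus; simpl; auto.
    - intros [H | H]; discriminate H. }
  rewrite <- Happ. apply (macro_eval _ _ _ _ HE _ HP), bare_result_application_eval.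
Qed.

Theorem theoremD8 :
  (forall F : construct -> Prop,
     macro_expresses lazy_lambda_calculus F ->
     macro_expresses inheritance_calculus F) /\
  (exists F : construct -> Prop,
     macro_expresses inheritance_calculus F /\
     ~ macro_expresses lazy_lambda_calculus F).
Proof.
  split.
  - intros F _. apply inheritance_calculus_macro_expresses.
  - exists (fun k => k = CMixin \/ k = CDef).
    split; [apply inheritance_calculus_macro_expresses |].
    apply lazy_lambda_calculus_not_macro_expresses.
Qed.
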